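(* Let $x$ be a solution on $[t_0,\infty)_{\mathbb{T}}$ of $$x^{\Delta}(t)=a(t)x(t)+b(t)x(\delta_{-}(h,t))\delta_{-}^{\Delta}(h,t),\qquad t\in[t_0,\infty)_{\mathbb{T}}.\tag{E}$$ Put $$Q(t):=a(t)+b(\delta_{+}(h,t)),\qquad \beta(t):=t-\delta_{-}(h,t),\qquad A(t):=x(t)+\int_{\delta_{-}(h,t)}^{t}b(\delta_{+}(h,s))x(s)\,\Delta s .$$ Assume that there exists $\lambda>0$ such that $$-\frac{\lambda\,\delta_{-}^{\Delta}(h,t)}{\beta(t)+\lambda[\beta(t)+\mu(t)]}\le Q(t)\le-\lambda[\beta(t)+\mu(t)]\,b(\delta_{+}(h,t))^{2}-\mu(t)Q^{2}(t)$$ for all $t\in[t_0,\infty)_{\mathbb{T}}$. If $$V(t)=A(t)^{2}+\lambda\int_{\delta_{-}(h,t)}^{t}\left(\int_{s}^{t}b(\delta_{+}(h,u))^{2}x(u)^{2}\,\Delta u\right)\Delta s,$$ then, along the solutions of (E), $$V^{\Delta}(t)\le Q(t)V(t)\quad\text{for all }t\in[t_0,\infty)_{\mathbb{T}}.$$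
   Context: A time scale $\mathbb{T}$ is a nonempty closed subset of $\mathbb{R}$; $\sigma(t)=\inf\{s\in\mathbb{T}:s>t\}$ is the forward jump operator, $\mu(t)=\sigma(t)-t$, $f^{\Delta}$ is the delta derivative, $\int\cdot\,\Delta s$ the delta integral, and $[a,b]_{\mathbb{T}}=[a,b]\cap\mathbb{T}$ (similarly for other intervals). ''rd-continuous'' means continuous at right-dense points with finite left-sided limits at left-dense points. Shift operators. Let $\mathbb{T}^{*}\subseteq\mathbb{T}$ be nonempty and $t_0\in\mathbb{T}^{*}$. Backward and forward shift operators $\delta_{-},\delta_{+}$ associated with the initial point $t_0$ are operators $\delta_{\pm}$ of $(s,t)\in[t_0,\infty)_{\mathbb{T}}\times\mathbb{T}^{*}$, with domains $\mathcal{D}_{\pm}=\{(s,t)\in[t_0,\infty)_{\mathbb{T}}\times\mathbb{T}^{*}:\delta_{\pm}(s,t)\in\mathbb{T}^{*}\}$ (pairs where the operator is defined with value in $\mathbb{T}^*$), satisfying: P.1: $\delta_{\pm}$ are strictly increasing in their second arguments, i.e. if $(T_0,t),(T_0,u)\in\mathcal{D}_{\pm}$, then $T_0\le t<u$ implies $\delta_{\pm}(T_0,t)<\delta_{\pm}(T_0,u)$. P.2: if $(T_1,u),(T_2,u)\in\mathcal{D}_{-}$ with $T_1<T_2$ then $\delta_{-}(T_1,u)>\delta_{-}(T_2,u)$; if $(T_1,u),(T_2,u)\in\mathcal{D}_{+}$ with $T_1<T_2$ then $\delta_{+}(T_1,u)<\delta_{+}(T_2,u)$. P.3: if $t\in[t_0,\infty)_{\mathbb{T}}$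 then $(t,t_0)\in\mathcal{D}_{+}$ and $\delta_{+}(t,t_0)=t$; if $t\in\mathbb{T}^{*}$ then $(t_0,t)\in\mathcal{D}_{+}$ and $\delta_{+}(t_0,t)=t$. P.4: if $(s,t)\in\mathcal{D}_{\pm}$ then $(s,\delta_{\pm}(s,t))\in\mathcal{D}_{\mp}$ and $\delta_{\mp}(s,\delta_{\pm}(s,t))=t$. P.5: if $(s,t)\in\mathcal{D}_{\pm}$ and $(u,\delta_{\pm}(s,t))\in\mathcal{D}_{\mp}$ then $(s,\delta_{\mp}(u,t))\in\mathcal{D}_{\pm}$ and $\delta_{\mp}(u,\delta_{\pm}(s,t))=\delta_{\pm}(s,\delta_{\mp}(u,t))$. Delay function. $\mathbb{T}$ is unbounded above, $h\in(t_0,\infty)_{\mathbb{T}}$ is a constant such that $(h,t)\in\mathcal{D}_{\pm}$ for all $t\in[t_0,\infty)_{\mathbb{T}}$, the function $t\mapsto\delta_{-}(h,t)$ is delta differentiable with rd-continuous derivative $\delta_{-}^{\Delta}(h,t)$, is strictly increasing, and maps $[t_0,\infty)_{\mathbb{T}}$ onto $[\delta_{-}(h,t_0),\infty)_{\mathbb{T}}$; its inverse is $\delta_{+}(h,\cdot)$. Standing assumptions: $t_0\ge 0$; $a,b:\mathbb{T}\to\mathbb{R}$ are rd-continuous; $|\delta_{-}^{\Delta}(h,t)|\le M<\infty$ for all $t\in[t_0,\infty)_{\mathbb{T}}$. A solution of (E) is $x=x(t,t_0,\psi)$ satisfying (E) on $[t_0,\infty)_{\mathbb{T}}$ with $x=\psi$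 on $[\delta_{-}(h,t_0),t_0]_{\mathbb{T}}$, where $\psi:[\delta_{-}(h,t_0),t_0]_{\mathbb{T}}\to\mathbb{R}$ is a given rd-continuous initial function. *)

(* Defs.v *)
From HB Require Import structures.
From mathcomp Require Import all_boot all_order all_algebra.
From mathcomp Require Import all_classical all_reals all_analysis.

Set Implicit Arguments.
Unset Strict Implicit.
Unset Printing Implicit Defensive.

Import Order.TTheory GRing.Theory Num.Theory.
Import numFieldNormedType.Exports.

Local Open Scope classical_set_scope.
Local Open Scope ring_scope.

(* Functions on a time scale T (or on a part D of it) are represented by total
   functions R -> R; only their values on D are ever used. *)
Section TimeScale.
Context {R : realType}.
Implicit Types (T D : set R) (f F : R -> R) (s t a b l : R).

Definition time_scale T := T !=set0 /\ closed T.

Definition ts_cc T a b : set R := T `&` `[a, b]%classic.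
Definition ts_co T a b : set R := T `&` `[a, b[%classic.
Definition ts_ge T a : set R := T `&` `[a, +oo[%classic.
Definition ts_gt T a : set R := T `&` `]a, +oo[%classic.

(* sigma is junk at a maximum of T and rho at a minimum of T; the former does not
   exist when T is unbounded above, and left_dense excludes the latter. *)
Definition sigma T t : R := inf [set s | T s /\ t < s].
Definition rho T t : R := sup [set s | T s /\ s < t].
Definition mu T t : R := sigma T t - t.

Definition right_dense T t := (exists2 s, T s & t < s) /\ sigma T t = t.
Definition left_dense T t := (exists2 s, T s & s < t) /\ rho T t = t.

(* f is a function on D `<=` T; points are classified as dense by the jump
   operators of T, limits are taken along D. *)
Definition rd_continuous T D f :=
  forall t, D t ->
    (right_dense T t -> f s @[s --> within D (nbhs t)] --> f t) /\
    (left_dense T t ->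
       exists l, f s @[s --> within (D `&` [set s | s < t]) (nbhs t)] --> l).

(* l is the delta derivative at t of a function f on D `<=` T: the jump operator
   is that of T, neighbourhoods are relative to D. *)
Definition is_delta_derive T D f t l :=
  forall e, 0 < e -> exists2 d, 0 < d &
    forall s, D s -> `|s - t| < d ->
      `|f (sigma T t) - f s - l * (sigma T t - s)| <= e * `|sigma T t - s|.

Definition delta_derivable T D f t := exists l, is_delta_derive T D f t l.

Definition delta_derive T D f t : R := get [set l | is_delta_derive T D f t l].

(* No derivative is required at b: if b is left-dense and right-scattered in T,
   then f b does not affect the integral over [a, b] and need not be the
   derivative of F at b along [a, b]. *)
Definition delta_antiderivative T f a b F :=
  {within ts_cc T a b, continuous F} /\
  forall t, ts_co T a b t -> is_delta_derive T (ts_cc T a b) F t (f t).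

(* The Cauchy delta integral F b - F a, with b < a allowed; it does not depend
   on the choice of the antiderivative F. *)
Definition delta_int T a b f : R :=
  get [set I | exists2 F,
    delta_antiderivative T f (Num.min a b) (Num.max a b) F & I = F b - F a].

End TimeScale.

Section Shift.
Context {R : realType}.
Implicit Types (T Ts : set R) (d dm dp : R -> R -> option R).

(* A shift operator is a partial operator: None means undefined. *)
Definition shift_val d (s t : R) : R := odflt 0 (d s t).

Definition shift_dom T Ts (t0 : R) d (s t : R) :=
  [/\ ts_ge T t0 s, Ts t & exists2 v, d s t = Some v & Ts v].

Definition shift_P1 T Ts t0 d :=
  forall (s t u : R), shift_dom T Ts t0 d s t -> shift_dom T Ts t0 d s u ->
    s <= t -> t < u -> shift_val d s t < shift_val d s u.

Definition shift_P2 T Ts t0 dm dp :=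
  (forall (s1 s2 u : R), shift_dom T Ts t0 dm s1 u -> shift_dom T Ts t0 dm s2 u ->
     s1 < s2 -> shift_val dm s2 u < shift_val dm s1 u) /\
  (forall (s1 s2 u : R), shift_dom T Ts t0 dp s1 u -> shift_dom T Ts t0 dp s2 u ->
     s1 < s2 -> shift_val dp s1 u < shift_val dp s2 u).

Definition shift_P3 T Ts t0 dp :=
  (forall t, ts_ge T t0 t ->
     shift_dom T Ts t0 dp t t0 /\ shift_val dp t t0 = t) /\
  (forall t, Ts t -> shift_dom T Ts t0 dp t0 t /\ shift_val dp t0 t = t).

Definition shift_P4 T Ts t0 d d' :=
  forall s t, shift_dom T Ts t0 d s t ->
    shift_dom T Ts t0 d' s (shift_val d s t) /\
    shift_val d' s (shift_val d s t) = t.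

(* The clause on (u, t) says that the point d' u t of Ts occurring in the other
   two clauses is defined. *)
Definition shift_P5 T Ts t0 d d' :=
  forall s t u, shift_dom T Ts t0 d s t ->
    shift_dom T Ts t0 d' u (shift_val d s t) ->
    [/\ shift_dom T Ts t0 d' u t,
        shift_dom T Ts t0 d s (shift_val d' u t) &
        shift_val d' u (shift_val d s t) = shift_val d s (shift_val d' u t)].

Definition shift_operators T Ts t0 dm dp :=
  [/\ Ts `<=` T, Ts t0,
      shift_P1 T Ts t0 dm /\ shift_P1 T Ts t0 dp,
      shift_P2 T Ts t0 dm dp /\ shift_P3 T Ts t0 dp &
      (shift_P4 T Ts t0 dm dp /\ shift_P4 T Ts t0 dp dm) /\
      (shift_P5 T Ts t0 dm dp /\ shift_P5 T Ts t0 dp dm)].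

Record delay_shift T Ts (t0 : R) dm dp (h : R) : Prop := DelayShift {
  delay_mem : ts_gt T t0 h;
  delay_dom : forall t, ts_ge T t0 t ->
    shift_dom T Ts t0 dm h t /\ shift_dom T Ts t0 dp h t;
  delay_derivable : forall t, ts_ge T t0 t ->
    delta_derivable T (ts_ge T t0) (shift_val dm h) t;
  delay_rd_continuous : rd_continuous T (ts_ge T t0)
    (delta_derive T (ts_ge T t0) (shift_val dm h));
  delay_increasing : forall t u, ts_ge T t0 t -> ts_ge T t0 u ->
    t < u -> shift_val dm h t < shift_val dm h u;
  delay_onto :
    shift_val dm h @` ts_ge T t0 = ts_ge T (shift_val dm h t0);
  delay_inverse : forall t, ts_ge T t0 t ->
    shift_val dp h (shift_val dm h t) = t }.

(* x solves
     x^Delta(t) = a(t) x(t) + b(t) x(g(t)) g^Delta(t),  t in [t0, oo)_T,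
   with initial function psi on [g(t0), t0]_T. As usual for delay equations the
   derivative at t0 is taken along [t0, oo)_T, so that no compatibility of the
   slope of psi with the equation is imposed when t0 is left-dense. *)
Definition delay_solution T (t0 : R) (a b g psi x : R -> R) :=
  (forall t, ts_cc T (g t0) t0 t -> x t = psi t) /\
  (forall t, ts_ge T t0 t ->
     delta_derivable T (ts_ge T t0) x t /\
     delta_derive T (ts_ge T t0) x t =
       a t * x t + b t * x (g t) * delta_derive T (ts_ge T t0) g t).

End Shift.

(* Main.v *)
Require Import Defs.
From HB Require Import structures.
From mathcomp Require Import all_boot all_order all_algebra.
From mathcomp Require Import all_classical all_reals all_analysis.
From mathcomp Require Import ring lra.

Set Implicit Arguments.
Unset Strict Implicit.
Unset Printing Implicit Defensive.

Import Order.TTheory GRing.Theory Num.Theory.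
Import numFieldNormedType.Exports.

Local Open Scope classical_set_scope.
Local Open Scope ring_scope.

(* With f = (b o k) x and antiderivatives B, W, Z on [g t0, oo)_T of f, f^2, W,
     A = x + (B - B o g),   V = A^2 + lambda ((t - g) W - (Z - Z o g)),
   where k = delta_+(h, .) and g = delta_-(h, .). Since g is an order isomorphism
   of [t0, oo)_T onto [g t0, oo)_T, it commutes with sigma, so the chain rule gives
   A^Delta = Q x and, writing g' for g^Delta,
     V^Delta = (2 A + mu Q x) Q x
               + lambda ((beta + mu (1 - g')) f^2 - g' (W - W o g)).
   The upper bound on Q absorbs the terms in x^2; the lower bound, together with
   (int f)^2 <= beta int f^2 and int int f^2 <= beta int f^2, absorbs the rest. *)

(** * Limits along a closed set and the jump operator *)

Section Near.
Context {R : realType}.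
Implicit Types (D E : set R) (f g : R -> R) (s t e l : R).

Lemma near_within_ballP D t (P : R -> Prop) :
  (\forall s \near within D (nbhs t), P s) <->
  exists2 d, 0 < d & forall s, D s -> `|s - t| < d -> P s.
Proof.
rewrite near_withinE; split=> [/nbhs_ballP[d /= d0 dP]|[d d0 dP]].
  by exists d => // s Ds st; apply: dP => //; rewrite /ball/= distrC.
apply/nbhs_ballP; exists d => // s /= st Ds; apply: dP => //.
by rewrite distrC.
Qed.

Lemma near_within_subset D E t (P : R -> Prop) : E `<=` D ->
  (\forall s \near within D (nbhs t), P s) ->
  \forall s \near within E (nbhs t), P s.
Proof.
move=> ED /near_within_ballP[d d0 H]; apply/near_within_ballP.
by exists d => // s /ED; exact: H.
Qed.

Lemma near_withinU D E t (P : R -> Prop) :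
  (\forall s \near within D (nbhs t), P s) ->
  (\forall s \near within E (nbhs t), P s) ->
  \forall s \near within (D `|` E) (nbhs t), P s.
Proof.
rewrite !near_withinE => DP EP; near=> s => -[Ds|Es].
  by apply: (near DP s).
by apply: (near EP s).
Unshelve. all: by end_near. Qed.

(** Off a closed set the trace filter is trivial. This disposes of a piece of a covering that does
    not contain the base point. *)
Lemma near_within_notin D t (P : R -> Prop) : closed D -> ~ D t ->
  \forall s \near within D (nbhs t), P s.
Proof.
move=> cD nDt; rewrite near_withinE.
have : nbhs t (~` D) by apply: open_nbhs_nbhs; split => //; exact: closed_openC.
by apply: filterS => s nDs Ds.
Qed.

Lemma cvg_within_subset D E f t l : E `<=` D ->
  f s @[s --> within D (nbhs t)] --> l ->
  f s @[s --> within E (nbhs t)] --> l.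
Proof.
move=> ED fl; apply/cvgrPdist_lt => e e0.
by apply: near_within_subset ED _; move/cvgrPdist_lt : fl; exact.
Qed.

Lemma cvg_withinU D E f t l :
  f s @[s --> within D (nbhs t)] --> l ->
  f s @[s --> within E (nbhs t)] --> l ->
  f s @[s --> within (D `|` E) (nbhs t)] --> l.
Proof.
move=> /cvgrPdist_lt fD /cvgrPdist_lt fE; apply/cvgrPdist_lt => e e0.
by apply: near_withinU; [exact: fD|exact: fE].
Qed.

(** Convergence to the value becomes convergence in the trace filter on [E], the form in which
    limits along subsets compose. *)
Lemma cvg_within_self D E f t : (forall s, D s -> E (f s)) ->
  f s @[s --> within D (nbhs t)] --> f t ->
  f s @[s --> within D (nbhs t)] --> within E (nbhs (f t)).
Proof.
move=> DE ft P EP; have /near_within_ballP[d d0 H] := ft _ EP.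
by apply/near_within_ballP; exists d => // s Ds st; apply: H => //; exact: DE.
Qed.

Lemma cvg_within_eq D f g t l : (forall s, D s -> f s = g s) ->
  f s @[s --> within D (nbhs t)] --> l ->
  g s @[s --> within D (nbhs t)] --> l.
Proof.
move=> fg; apply: cvg_trans; apply: near_eq_cvg.
by rewrite near_withinE; apply: nearW => s /fg ->.
Qed.

End Near.

Section Jump.
Context {R : realType} (T : set R).
Hypotheses (Tcl : closed T) (Tub : ~ has_ubound T).
Implicit Types (D : set R) (f : R -> R) (s t u c e : R).

Lemma ts_geE c t : ts_ge T c t <-> T t /\ c <= t.
Proof. by split=> -[Tt /=]; [|move=> ct; split=> //=]; rewrite in_itv/= andbT. Qed.

Lemma exists_gt t : exists2 s, T s & t < s.
Proof.
apply/not_exists2P => H; apply: Tub; exists t => s Ts; rewrite leNgt.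
by case: (H s) => // /negP.
Qed.

Lemma has_inf_gt t : has_inf [set s | T s /\ t < s].
Proof.
have [s Ts ts] := exists_gt t.
by split; [exists s|exists t => ? [_ /ltW]].
Qed.

Lemma sigma_ge t : t <= sigma T t.
Proof. by apply: lb_le_inf; [case: (has_inf_gt t)|move=> ? [_ /ltW]]. Qed.

Lemma sigma_le s t : T s -> t < s -> sigma T t <= s.
Proof. by move=> Ts ts; apply: ge_inf => //; case: (has_inf_gt t). Qed.

Lemma sigma_mem t : T (sigma T t).
Proof.
apply: Tcl => B /nbhs_ballP[e /= e0 eB].
have [s [Ts ts] se] := inf_adherent e0 (has_inf_gt t).
have st := sigma_le Ts ts; exists s; split=> //.
by apply: eB; rewrite /ball/= distrC ger0_norm ?subr_ge0// ltrBlDl.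
Qed.

Lemma mu_ge0 t : 0 <= mu T t.
Proof. by rewrite subr_ge0 sigma_ge. Qed.

Lemma right_denseE t : right_dense T t <-> sigma T t = t.
Proof. by split=> [[]|]//; split=> //; exact: exists_gt. Qed.

Lemma right_dense_near t e : sigma T t = t -> 0 < e ->
  exists2 s, T s & t < s < t + e.
Proof.
move=> tt e0; have [s [Ts ts] se] := inf_adherent e0 (has_inf_gt t).
by exists s => //; rewrite ts/= -[X in X + _]tt.
Qed.

(** Turns a metric bound on the right of [t] into an order condition, which an order isomorphism can
    carry over. The cut is a nearby point if [t] is right-dense, and [sigma T t] if it is
    right-scattered. *)
Lemma right_cut t e : 0 < e ->
  exists u, [/\ T u, t < u & forall s, T s -> t <= s -> s < u -> s < t + e].
Proof.
move=> e0; have := sigma_ge t; rewrite le_eqVlt => /predU1P[/esym tt|tt].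
  have [s Ts /andP[ts st]] := right_dense_near tt e0.
  by exists s; split=> // r _ _ rs; lra.
exists (sigma T t); split=> // [|s Ts]; first exact: sigma_mem.
rewrite le_eqVlt => /predU1P[<-|ts]; first lra.
by have := sigma_le Ts ts; lra.
Qed.

Lemma left_cut c t e : T c -> c < t -> 0 < e ->
  exists u, [/\ T u, c <= u, u < t & forall s, T s -> s <= t -> u < s -> t - e < s].
Proof.
move=> Tc ct e0.
have [[v [Tv tv vt]]|nv] := pselect (exists v, [/\ T v, t - e < v & v < t]).
  exists (Num.max c v); split; rewrite ?le_max ?lexx ?gt_max ?ct//.
    by case: (leP c v).
  by move=> s _ _; rewrite gt_max => /andP[_]; lra.
(* With no point of [T] strictly between [t - e] and [t], the cut is the last point of [T] up to
   [t - e]; it exists because [T] is closed and [c] lies there. *)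
pose S := T `&` [set s | s <= t - e].
have Sc : S c.
  by split=> //=; rewrite leNgt; apply/negP => h; apply: nv; exists c.
have Ss : has_sup S by split; [exists c|exists (t - e) => ? []].
have Scl : closed S by apply: closedI => //; exact: closed_le.
have [Tsup supe] : S (sup S).
  by apply: Scl; apply: closure_sup; [exists c|exists (t - e) => ? []].
exists (sup S); split=> //.
- by apply: ub_le_sup => //; exists (t - e) => ? [].
- by move: supe => /=; lra.
- move=> s Ts _ Ss'; rewrite ltNge; apply/negP => se.
  have : s <= sup S by apply: ub_le_sup => //; exists (t - e) => ? [].
  by rewrite leNgt Ss'.
Qed.

End Jump.

(** * Delta derivatives *)

Section DeltaDerivative.
Context {R : realType} (T : set R).
Implicit Types (D E : set R) (f g : R -> R) (s t u c e l m : R).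

(** This makes the calculus rules consequences of limit algebra. The point removed is [sigma T t],
    not [t]: at a right-scattered [t] the quotient at [s = t] takes part and fixes the jump of
    [f]. *)
Lemma is_delta_deriveP D f t l : is_delta_derive T D f t l <->
  (f (sigma T t) - f s) / (sigma T t - s)
    @[s --> within (D `\ sigma T t) (nbhs t)] --> l.
Proof.
have quot s : s != sigma T t -> f (sigma T t) - f s =
    (f (sigma T t) - f s) / (sigma T t - s) * (sigma T t - s).
  by move=> st; rewrite divfK// subr_eq0 eq_sym.
split=> [H|/cvgrPdist_le H e e0].
  apply/cvgrPdist_le => e e0; have [d d0 dH] := H _ e0.
  apply/near_within_ballP; exists d => // s [Ds /eqP ss] sd.
  have := dH _ Ds sd; rewrite [X in X - l * _]quot// -mulrBl normrM distrC.
  by rewrite ler_pM2r// normr_gt0 subr_eq0 eq_sym.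
have /near_within_ballP[d d0 dH] := H _ e0; exists d => // s Ds sd.
have [->|ss] := eqVneq s (sigma T t); first by rewrite !subrr mulr0 subr0 normr0 mulr0.
rewrite [X in X - l * _]quot// -mulrBl normrM distrC ler_wpM2r//.
by apply: dH => //; split=> //; apply/eqP.
Qed.

Lemma is_delta_derive_sub D E f t l : E `<=` D ->
  is_delta_derive T D f t l -> is_delta_derive T E f t l.
Proof.
move=> ED H e e0; have [d d0 dH] := H _ e0; exists d => // s Es.
exact/dH/ED.
Qed.

Lemma eq_is_delta_derive D f g t l : D (sigma T t) -> {in D, f =1 g} ->
  is_delta_derive T D f t l -> is_delta_derive T D g t l.
Proof.
move=> Dt fg H e e0; have [d d0 dH] := H _ e0; exists d => // s Ds.
by rewrite -!fg ?inE//; exact: dH.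
Qed.

(** Put [s = t] in the definition and let [e] tend to 0. *)
Lemma is_delta_derive_sigma D f t l : D t -> is_delta_derive T D f t l ->
  f (sigma T t) = f t + l * mu T t.
Proof.
move=> Dt H; apply/eqP; rewrite -subr_eq0 opprD addrA -normr_le0.
apply/ler_addgt0Pl => e e0; rewrite addr0.
have e1 : 0 < e / (`|mu T t| + 1) by rewrite divr_gt0// ltr_wpDl.
have [d d0 dH] := H _ e1; have := dH _ Dt; rewrite subrr normr0 => /(_ d0).
move/le_trans; apply; rewrite -/(mu T t) mulrAC ler_pdivrMr ?ltr_wpDl//.
by rewrite ler_pM2l// lerDl.
Qed.

Lemma is_delta_derive_cvg D f t l : D t -> is_delta_derive T D f t l ->
  f s @[s --> within D (nbhs t)] --> f t.
Proof.
move=> Dt H; have Ht := is_delta_derive_sigma Dt H.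
apply/cvgrPdist_le => e e0.
set m := `|mu T t| + 1; have m0 : 0 < m by rewrite ltr_wpDl.
set k := `|l| + 1; have k0 : 0 < k by rewrite ltr_wpDl.
have e1 : 0 < e / (m *+ 2) by rewrite divr_gt0// mulrn_wgt0.
have [d d0 dH] := H _ e1.
apply/near_within_ballP; exists (Num.min d (Num.min 1 (e / (k *+ 2)))).
  by rewrite !lt_min d0 ltr01/= divr_gt0// mulrn_wgt0.
move=> s Ds; rewrite !lt_min => /and3P[sd s1 sk].
have := dH _ Ds sd; rewrite Ht.
(* The jump cancels, so [f t - f s] is the defect from the definition plus [l * (t - s)]. Each is at
   most [e / 2]; for the first, [|s - t| < 1] gives [|sigma T t - s| <= m]. *)
have -> : f t + l * mu T t - f s - l * (sigma T t - s) = (f t - f s) - l * (t - s).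
  by rewrite /mu; ring.
move=> Hs.
have : `|f t - f s| <= e / (m *+ 2) * m + k * (e / (k *+ 2)).
  rewrite -[f t - f s](subrK (l * (t - s))); apply: (le_trans (ler_normD _ _)).
  apply: lerD.
    apply: (le_trans Hs); rewrite ler_pM2l//.
    have -> : sigma T t - s = mu T t + (t - s) by rewrite /mu; ring.
    by apply: (le_trans (ler_normD _ _)); rewrite lerD2l distrC ltW.
  rewrite normrM distrC; apply: ler_pM => //; last exact: ltW.
  by rewrite lerDl.
suff -> : e / (m *+ 2) * m + k * (e / (k *+ 2)) = e by [].
by field; rewrite !gt_eqF.
Qed.

Lemma is_delta_derive_cst D c t : is_delta_derive T D (cst c) t 0.
Proof.
move=> e e0; exists 1 => // s _ _.
by rewrite subrr mul0r subr0 normr0 mulr_ge0// ltW.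
Qed.

Lemma is_delta_derive_id D t : is_delta_derive T D id t 1.
Proof.
move=> e e0; exists 1 => // s _ _.
by rewrite mul1r subrr normr0 mulr_ge0// ltW.
Qed.

Lemma is_delta_deriveD D f g t l m : is_delta_derive T D f t l ->
  is_delta_derive T D g t m -> is_delta_derive T D (f \+ g) t (l + m).
Proof.
move=> /is_delta_deriveP Hf /is_delta_deriveP Hg; apply/is_delta_deriveP.
apply: cvg_within_eq (cvgD Hf Hg) => s _ /=.
by rewrite -mulrDl; congr (_ / _); ring.
Qed.

Lemma is_delta_deriveM D f g t l m : D t -> is_delta_derive T D f t l ->
  is_delta_derive T D g t m ->
  is_delta_derive T D (f \* g) t (l * g t + f (sigma T t) * m).
Proof.
move=> Dt /is_delta_deriveP Hf Hg; have gt := is_delta_derive_cvg Dt Hg.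
move/is_delta_deriveP in Hg; apply/is_delta_deriveP.
have gt' := cvg_within_subset (@subDsetl _ _ [set sigma T t]) gt.
have ft : f (sigma T t) @[_ --> within (D `\ sigma T t) (nbhs t)] -->
    f (sigma T t) by exact: cvg_cst.
apply: cvg_within_eq (cvgD (cvgM Hf gt') (cvgM ft Hg)) => s _ /=.
by rewrite mulrAC mulrA -mulrDl; congr (_ / _); ring.
Qed.

Lemma is_delta_deriveZ D f t c l : D t -> is_delta_derive T D f t l ->
  is_delta_derive T D (c \*o f) t (c * l).
Proof.
move=> Dt Hf; have := is_delta_deriveM Dt (is_delta_derive_cst D c t) Hf.
by rewrite mul0r add0r.
Qed.

Lemma is_delta_deriveB D f g t l m : D t -> is_delta_derive T D f t l ->
  is_delta_derive T D g t m -> is_delta_derive T D (f \- g) t (l - m).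
Proof.
move=> Dt Hf Hg; have := is_delta_deriveD Hf (is_delta_deriveZ (-1) Dt Hg).
by rewrite mulN1r; congr is_delta_derive; apply/funext => s /=; rewrite mulN1r.
Qed.

(** Since [g] commutes with the jump at [t], the quotient of [f \o g] is that of [f] at [g t] times
    that of [g]; injectivity at [sigma T t] keeps the middle denominator nonzero. *)
Lemma is_delta_derive_comp D E f g t l m : D t -> (forall s, D s -> E (g s)) ->
  (forall s, D s -> g s = g (sigma T t) -> s = sigma T t) ->
  g (sigma T t) = sigma T (g t) ->
  is_delta_derive T E f (g t) l -> is_delta_derive T D g t m ->
  is_delta_derive T D (f \o g) t (l * m).
Proof.
move=> Dt DE ginj gsigma /is_delta_deriveP Hf Hg.
have gt := is_delta_derive_cvg Dt Hg.
move/is_delta_deriveP in Hg; apply/is_delta_deriveP.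
have gt' : g s @[s --> within (D `\ sigma T t) (nbhs t)] -->
    within (E `\ sigma T (g t)) (nbhs (g t)).
  apply: cvg_within_self; last exact: cvg_within_subset gt.
  move=> s [Ds st]; split; first exact: DE.
  by rewrite -gsigma => /(ginj _ Ds)/st.
apply: cvg_within_eq (cvgM (cvg_comp _ _ gt' Hf) Hg) => s [Ds st] /=.
rewrite -gsigma mulrA divfK// subr_eq0 eq_sym; apply/eqP => /ginj.
by move/(_ Ds).
Qed.

End DeltaDerivative.

(** * Sign of the delta derivative, monotonicity, and uniqueness of the integral *)

Section Monotone.
Context {R : realType} (T : set R).
Hypotheses (Tcl : closed T) (Tub : ~ has_ubound T).
Implicit Types (f g F G : R -> R) (a b s t c e l m : R).

Lemma ts_ge_sigma c t : ts_ge T c t -> ts_ge T c (sigma T t).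
Proof.
move=> [Tt /=]; rewrite in_itv/= andbT => ct; split; first exact: sigma_mem.
by rewrite /= in_itv/= andbT (le_trans ct)// sigma_ge.
Qed.

Lemma ts_cc_sigma a b t : T b -> ts_co T a b t -> ts_cc T a b (sigma T t).
Proof.
move=> Tb [Tt /=]; rewrite in_itv/= => /andP[at_ tb]; split; first exact: sigma_mem.
by rewrite /= in_itv/= (le_trans at_ (sigma_ge Tub t)) sigma_le.
Qed.

(** The punctured set meets every neighbourhood of [t]: in [t] itself if [t] is right-scattered,
    otherwise in points of [T] to its right. Hence limits of difference quotients are unique. *)
Lemma within_sigma_proper c t : ts_ge T c t ->
  ProperFilter (within (ts_ge T c `\ sigma T t) (nbhs t)).
Proof.
move=> Dt; apply: within_nbhs_proper => B /nbhs_ballP[e /= e0 eB].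
have [tt|tt] := eqVneq (sigma T t) t; last first.
  exists t; split; last exact/eB/ballxx.
  by split=> //= tt'; rewrite -tt' eqxx in tt.
have [s Ts /andP[ts se]] := right_dense_near Tub tt e0.
exists s; split; last first.
  by apply: eB; rewrite /ball/= distrC gtr0_norm ?subr_gt0// ltrBlDl.
split; last by rewrite tt/= => st; rewrite st ltxx in ts.
split=> //; move: Dt => [_ /=]; rewrite !in_itv/= !andbT => ct.
exact: le_trans ct (ltW ts).
Qed.

Lemma is_delta_derive_unique c f t l m : ts_ge T c t ->
  is_delta_derive T (ts_ge T c) f t l -> is_delta_derive T (ts_ge T c) f t m ->
  l = m.
Proof.
move=> /within_sigma_proper ? /is_delta_deriveP Hl /is_delta_deriveP Hm.
by apply: cvg_unique Hl Hm; exact: norm_hausdorff.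
Qed.

Lemma is_delta_derive_homo_ge0 c f t l : ts_ge T c t ->
  (forall s r, ts_ge T c s -> ts_ge T c r -> s < r -> f s <= f r) ->
  is_delta_derive T (ts_ge T c) f t l -> 0 <= l.
Proof.
move=> Dt fhomo /is_delta_deriveP Hl; have ? := within_sigma_proper Dt.
apply: (cvgr_to_ge Hl); rewrite near_withinE; apply: nearW => s [Ds /= /eqP ss].
have Dst := ts_ge_sigma Dt.
have [st|st|st] := ltgtP s (sigma T t); last by rewrite st eqxx in ss.
  by rewrite divr_ge0 ?subr_ge0 ?fhomo// ltW.
by rewrite -mulrNN -invrN !opprB divr_ge0 ?subr_ge0 ?fhomo// ltW.
Qed.

Lemma delta_deriveE c f t l : ts_ge T c t ->
  is_delta_derive T (ts_ge T c) f t l -> delta_derive T (ts_ge T c) f t = l.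
Proof.
by move=> Dt H; apply: (is_delta_derive_unique Dt _ H); exact: getI H.
Qed.

Lemma delta_derivableP c f t : ts_ge T c t ->
  delta_derivable T (ts_ge T c) f t ->
  is_delta_derive T (ts_ge T c) f t (delta_derive T (ts_ge T c) f t).
Proof. by move=> Dt [l Hl]; rewrite (delta_deriveE Dt Hl). Qed.

(** A supremum argument: for each small [e], the bound [f a - e * (s - a) <= f s] holds up to a last
    point; continuity puts that point in the set, and the derivative there pushes the bound further
    right unless the point is [b]. *)
Lemma delta_derive_ge0_le a b f : T a -> T b -> a <= b ->
  {within ts_cc T a b, continuous f} ->
  (forall t, ts_co T a b t ->
     exists2 l, 0 <= l & is_delta_derive T (ts_cc T a b) f t l) ->
  f a <= f b.
Proof.
move=> Ta Tb ab /subspace_continuousP fcont Hf.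
apply/ler_addgt0Pl => e e0; have [->|neab] := eqVneq a b; first lra.
have {neab}ab0 : 0 < b - a by rewrite subr_gt0 lt_neqAle neab.
suff : f a - e / (b - a) * (b - a) <= f b.
  by rewrite divfK ?gt_eqF//; lra.
have {e0} : 0 < e / (b - a) by rewrite divr_gt0.
move: (e / (b - a)) => {}e e0.
pose S := [set t | ts_cc T a b t /\
  forall s, ts_cc T a b s -> s <= t -> f a - e * (s - a) <= f s].
have Sa : S a.
  split=> [|s [_ /=]]; first by split=> //=; rewrite in_itv/= lexx.
  rewrite in_itv/= => /andP[as_ _] sa.
  have -> : s = a by apply/eqP; rewrite eq_le sa.
  by rewrite subrr mulr0 subr0.
have Sub : has_ubound S by exists b => t [[_ /=]]; rewrite in_itv/= => /andP[].
have SS : has_sup S by split=> //; exists a.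
have Sle s : S s -> s <= sup S by move=> ?; exact: ub_le_sup.
set c := sup S.
have Dc : ts_cc T a b c.
  have Dcl : closed (ts_cc T a b) by apply: closedI => //; exact: itv_closed.
  apply: Dcl; apply: (@closureS _ S) => [t []//|].
  by apply: closure_sup => //; exists a.
have Sc : S c.
  split=> // s Ds; rewrite le_eqVlt => /predU1P[->|sc]; last first.
    have cs0 : 0 < c - s by rewrite subr_gt0.
    have [r [_ rS] sr] := sup_adherent cs0 SS.
    by apply: rS => //; move: sr; rewrite -/c; lra.
  (* A failure at [c] would, by continuity, persist at points of [S] just below [c], where the
     required bound is no lower. *)
  rewrite leNgt; apply/negP => lt.
  have /cvgrPdist_lt /(_ (f a - e * (c - a) - f c)) := fcont _ Dc.
  rewrite subr_gt0 => /(_ lt)/near_within_ballP[d d0 dH].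
  have [r Sr rc] := sup_adherent d0 SS; have := Sle _ Sr; rewrite -/c in rc *.
  move=> rc'; have [Dr /(_ _ Dr (lexx r)) H] := Sr.
  have : `|f c - f r| < f a - e * (c - a) - f c.
    by apply: dH => //; rewrite distrC ger0_norm; lra.
  rewrite ltr_norml => /andP[].
  have : e * (r - a) <= e * (c - a) by rewrite ler_pM2l//; lra.
  lra.
have [_ /=] := Dc; rewrite in_itv/= => /andP[ac].
rewrite le_eqVlt => /predU1P[cb|cb].
  by have [_ /(_ _ Dc (lexx _))] := Sc; rewrite cb.
(* Below [b] the set extends past [c]: to a point of [T] slightly to the right if [c] is
   right-dense, to [sigma T c] otherwise. *)
exfalso.
have Dc' : ts_co T a b c by case: Dc => Tc _; split=> //=; rewrite in_itv/= ac.
have [l l0 Hl] := Hf _ Dc'; have [d d0 dH] := Hl _ e0.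
have [_ Hc] := Sc; have Hcc := Hc _ Dc (lexx _).
have [sc|sc] := eqVneq (sigma T c) c.
  have m0 : 0 < Num.min d (b - c) by rewrite lt_min d0 subr_gt0.
  have [r Tr /andP[cr]] := right_dense_near Tub sc m0.
  rewrite -ltrBlDl lt_min => /andP[rd rb].
  have : S r.
    split; first by split=> //=; rewrite in_itv/=; apply/andP; split; lra.
    move=> s Ds sr; have [|cs] := leP s c; first exact: Hc.
    have := dH _ Ds; rewrite sc [`|s - c|]gtr0_norm ?subr_gt0// [`|c - s|]distrC.
    rewrite [`|s - c|]gtr0_norm ?subr_gt0// => /(_ _).
    have : 0 <= l * (s - c) by rewrite mulr_ge0//; lra.
    move=> ? /(_ (le_lt_trans (lerB sr (lexx c)) rd)).
    by rewrite ler_norml => /andP[]; lra.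
  by move/Sle; rewrite leNgt cr.
have {}sc : c < sigma T c by rewrite lt_neqAle eq_sym sc sigma_ge.
have : S (sigma T c).
  split; first exact: ts_cc_sigma.
  move=> s Ds ss; have [|cs] := leP s c; first exact: Hc.
  have {ss} -> : s = sigma T c.
    by apply/eqP; rewrite eq_le ss sigma_le//; case: Ds.
  have := dH _ Dc; rewrite subrr normr0 => /(_ d0).
  have : 0 <= l * (sigma T c - c) by rewrite mulr_ge0//; lra.
  rewrite [`|_ - c|]gtr0_norm ?subr_gt0// => ?.
  by rewrite ler_norml => /andP[]; lra.
by move/Sle; rewrite leNgt sc.
Qed.

(** Two antiderivatives differ by a function with zero derivative, which is monotone both ways; so
    the set under [get] is a singleton. *)
Lemma delta_intE a b f F : T a -> T b -> a <= b ->
  delta_antiderivative T f a b F -> delta_int T a b f = F b - F a.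
Proof.
move=> Ta Tb ab HF; rewrite /delta_int min_l// max_r//.
have le F1 F2 : delta_antiderivative T f a b F1 ->
    delta_antiderivative T f a b F2 -> F1 b - F1 a <= F2 b - F2 a.
  move=> [c1 d1] [c2 d2].
  suff : (F2 \- F1) a <= (F2 \- F1) b by rewrite /=; lra.
  apply: delta_derive_ge0_le => // [|t Dt].
    apply/subspace_continuousP => t Dt.
    by move/subspace_continuousP in c1; move/subspace_continuousP in c2;
      apply: cvgB; [exact: c2|exact: c1].
  exists 0 => //; rewrite -(subrr (f t)).
  apply: is_delta_deriveB; [|exact: d2|exact: d1].
  case: Dt => Tt /=; rewrite in_itv/= => /andP[at_ /ltW tb].
  by split=> //=; rewrite in_itv/= at_.
apply: get_subset1; first by exists F.
by move=> _ _ [F1 H1 ->] [F2 H2 ->]; apply/eqP; rewrite eq_le !le.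
Qed.

End Monotone.

(** * Existence of antiderivatives *)

(** This and [right_dense_continuous] are the consequences of rd-continuity from which
    antiderivatives are built; they pass to the products, compositions and glued functions that
    occur here. *)
Definition locally_bounded {R : realType} (D : set R) (f : R -> R) :=
  forall t, D t -> exists K, \forall s \near within D (nbhs t), `|f s| <= K.

Definition right_dense_continuous {R : realType} (T D : set R) (f : R -> R) :=
  forall t, D t -> sigma T t = t -> f s @[s --> within D (nbhs t)] --> f t.

Section Antiderivative.
Context {R : realType} (T : set R) (c : R) (f : R -> R).
Hypotheses (Tcl : closed T) (Tub : ~ has_ubound T) (Tc : T c).
Hypotheses (fbd : locally_bounded (ts_ge T c) f).
Implicit Types (F G : R -> R) (r s t e K m N : R).

Let D := ts_ge T c.

Let Dge s : D s -> c <= s.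
Proof. by move=> [_ /=]; rewrite in_itv/= andbT. Qed.

Let Dc : D c.
Proof. by split=> //=; rewrite in_itv/= lexx. Qed.

Lemma locally_bounded_segment N :
  exists K, forall s, ts_ge T c s -> s <= N -> `|f s| <= K.
Proof.
have Dcl : closed D by apply: closedI => //; exact: interval_closed.
have /compact_near_coveringP cov := @segment_compact R c N.
(* Compactness as near-covering: the bound runs to [+oo], so finitely many local bounds are
   dominated at once. *)
have [K [_ HK]] : \forall K \near +oo, `[c, N]%classic `<=` [set s | D s -> `|f s| <= K].
  apply: cov => s _.
  have [K HK] : exists K, \forall r \near within D (nbhs s), `|f r| <= K.
    by have [/fbd//|nDs] := pselect (D s); exists 0; exact: near_within_notin.
  rewrite near_withinE in HK.
  near=> r L; have KL : K <= L by near: L; apply: nbhs_pinfty_ge; rewrite num_real.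
  by move=> Dr; apply: le_trans KL; exact: (near HK r).
exists (K + 1) => s Ds sN; apply: HK => //; first by rewrite ltrDl.
by rewrite /= in_itv/= Dge.
Unshelve. all: by end_near. Qed.

(** Akin to the minor functions of the Perron integral. The bound [m] is tested on [[s, r[] only, as
    the value at a right endpoint does not enter a delta integral. *)
Let minorant t G := G c = 0 /\ forall s r m, D s -> D r -> s < r -> r <= t ->
  (forall u, D u -> s <= u -> u < r -> f u <= m) -> G r - G s <= m * (r - s).

Let values t := [set G t | G in minorant t].

Let values_has_sup t : D t -> has_sup (values t).
Proof.
move=> Dt; have [K HK] := locally_bounded_segment t.
have K0 : 0 <= K by apply: le_trans (HK _ Dc (Dge Dt)).
split.
  (* The line of slope [- K] is a competitor, because any upper bound of [f] on one of the intervals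
     is at least [- K]. *)
  exists (- K * (t - c)); exists (fun s => - K * (s - c)) => //.
  split=> [|s r m Ds Dr sr rt H]; first by rewrite subrr mulr0.
  have -> : - K * (r - c) - - K * (s - c) = - K * (r - s) by ring.
  apply: ler_wpM2r; first by rewrite subr_ge0 ltW.
  apply: le_trans (H _ Ds (lexx s) sr).
  have := HK _ Ds (le_trans (ltW sr) rt); rewrite ler_norml => /andP[]; lra.
exists (K * (t - c)) => _ [G [G0 HG] <-].
have := Dge Dt; rewrite (le_eqVlt c) => /predU1P[<-|ct].
  by rewrite G0 subrr mulr0.
rewrite -[G t]subr0 -G0; apply: HG => // u Du _ ut.
by apply: le_trans (HK _ Du (ltW ut)); exact: ler_norm.
Qed.

(* The largest function vanishing at [c] whose increments are at most the upper
   bounds of [f]; extending a competitor with slope [m] past [s] shows that its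
   increments are also at least the lower bounds of [f]. *)
Lemma exists_primitive_bounds : exists F, forall s t m M,
  ts_ge T c s -> ts_ge T c t -> s < t ->
  (forall r, ts_ge T c r -> s <= r -> r < t -> m <= f r <= M) ->
  m * (t - s) <= F t - F s <= M * (t - s).
Proof.
exists (fun t => sup (values t)) => s t m M Ds Dt st fmM.
have sups G : minorant s G -> G s <= sup (values s).
  by move=> HG; apply: ub_le_sup; [case: (values_has_sup Ds)|exists G].
have supt G : minorant t G -> G t <= sup (values t).
  by move=> HG; apply: ub_le_sup; [case: (values_has_sup Dt)|exists G].
apply/andP; split.
  rewrite lerBrDl -lerBrDr; apply: ge_sup; first by case: (values_has_sup Ds).
  move=> _ [G [G0 HG] <-]; rewrite lerBrDr.
  pose G' r := if r <= s then G r else G s + m * (r - s).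
  have -> : G s + m * (t - s) = G' t by rewrite /G' leNgt st.
  apply: supt; split=> [|r u M' Dr Du ru ut fM']; first by rewrite /G' Dge.
  rewrite /G'; have [us|su] := leP u s; have [rs|sr] := leP r s.
  - exact: HG.
  - by have := lt_trans ru (le_lt_trans us sr); rewrite ltxx.
  (* The increment from [r] to [u] is split at [s]. There [m <= f s <= M'], so the added piece of
     slope [m] respects the bound [M']. *)
  - have mM' : m <= M'.
      apply: (le_trans _ (fM' _ Ds rs su)).
      by have /andP[] := fmM _ Ds (lexx s) st.
    have H1 : m * (u - s) <= M' * (u - s).
      by apply: ler_wpM2r => //; rewrite subr_ge0 ltW.
    have H2 : G s - G r <= M' * (s - r).
      move: rs; rewrite le_eqVlt => /predU1P[->|rs]; first by rewrite !subrr mulr0.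
      by apply: HG => // v Dv rv vs; apply: fM' => //; exact: lt_trans vs su.
    have -> : M' * (u - r) = M' * (u - s) + M' * (s - r) by ring.
    lra.
  - have -> : G s + m * (u - s) - (G s + m * (r - s)) = m * (u - r) by ring.
    apply: ler_wpM2r; first by rewrite subr_ge0 ltW.
    apply: (le_trans _ (fM' _ Dr (lexx r) ru)).
    by have /andP[] := fmM _ Dr (ltW sr) (lt_le_trans ru ut).
rewrite lerBlDr; apply: ge_sup; first by case: (values_has_sup Dt).
move=> _ [G [G0 HG] <-].
(* A competitor up to [t] is one up to [s], so its value at [s] is at most the supremum there. *)
have Hs : minorant s G.
  split=> // u r m' Du Dr ur rs; apply: HG => //; exact: le_trans rs (ltW st).
suff : G t - G s <= M * (t - s) by have := sups _ Hs; lra.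
by apply: HG => // u Du su ut; have /andP[] := fmM _ Du su ut.
Qed.

Hypothesis frd : right_dense_continuous T (ts_ge T c) f.

(** At a right-dense [t], continuity keeps [f] within [e] of [f t], and the bounds on increments
    give the derivative. At a right-scattered [t] the jump is exact, and the error from the left is
    of order [t - s], small against the fixed length [sigma T t - t]. *)
Lemma exists_antiderivative :
  exists F, forall t, ts_ge T c t -> is_delta_derive T (ts_ge T c) F t (f t).
Proof.
have [F HF] := exists_primitive_bounds; exists F => t Dt e e0.
have := sigma_ge Tub t; rewrite le_eqVlt => /predU1P[/esym tt|tt].
  have /cvgrPdist_le/(_ _ e0)/near_within_ballP[d d0 dH] := frd Dt tt.
  exists d => // s Ds sd; rewrite tt.
  have close r : D r -> `|r - t| < d -> f t - e <= f r <= f t + e.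
    by move=> Dr rt; have := dH _ Dr rt; rewrite ler_norml => /andP[? ?]; lra.
  have [st|ts|->] := ltgtP s t; last by rewrite !subrr mulr0 subr0 normr0 mulr0.
  - have /andP[] : (f t - e) * (t - s) <= F t - F s <= (f t + e) * (t - s).
      apply: HF => // r Dr sr rt; apply: close => //.
      by move: sd; rewrite !ltr0_norm; lra.
    rewrite [`|t - s|]gtr0_norm ?subr_gt0// => ? ?.
    by rewrite ler_norml; apply/andP; split; lra.
  - have /andP[] : (f t - e) * (s - t) <= F s - F t <= (f t + e) * (s - t).
      apply: HF => // r Dr tr rs; apply: close => //.
      by move: sd; rewrite !ger0_norm; lra.
    rewrite [`|t - s|]ltr0_norm ?subr_lt0// => ? ?.
    by rewrite ler_norml; apply/andP; split; lra.
(* Only [t] lies in [[t, sigma T t[], so [f t] serves as both lower and upper bound. *)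
have Ft : F (sigma T t) - F t = f t * (sigma T t - t).
  apply/eqP; rewrite eq_le andbC; apply: HF => //; first exact: ts_ge_sigma.
  move=> r [Tr _]; rewrite le_eqVlt => /predU1P[<-|tr]; first by rewrite lexx.
  by move=> /(le_lt_trans (sigma_le Tub Tr tr)); rewrite ltxx.
have [K /near_within_ballP[d d0 dH]] := fbd Dt.
have K0 : 0 <= K by apply: le_trans (dH _ Dt _) => //; rewrite subrr normr0.
set mu := sigma T t - t in Ft *; have mu0 : 0 < mu by rewrite subr_gt0.
set L := K + `|f t| + 1; have L0 : 0 < L by rewrite ltr_wpDl// addr_ge0.
(* The bound [mu] excludes points right of [t]; the last one makes the error [L * (t - s)] at most
   [e * mu], where [mu <= sigma T t - s]. *)
exists (Num.min d (Num.min mu (e * mu / L))).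
  by rewrite !lt_min d0 mu0 divr_gt0// mulr_gt0.
move=> s Ds; rewrite !lt_min => /and3P[sd smu sL].
have [st|ts|->] := ltgtP s t; last first.
- by rewrite Ft subrr normr0 mulr_ge0// ltW.
- have := sigma_le Tub Ds.1 ts; move: smu; rewrite gtr0_norm ?subr_gt0// /mu.
  lra.
have {}Ft : F (sigma T t) - F s - f t * (sigma T t - s) = F t - F s - f t * (t - s).
  by move: Ft; rewrite /mu; lra.
have ts0 : 0 < t - s by rewrite subr_gt0.
have /andP[H1 H2] : - K * (t - s) <= F t - F s <= K * (t - s).
  apply: HF => // r Dr sr rt; rewrite -ler_norml; apply: dH => //.
  by move: sd; rewrite !ltr0_norm; lra.
have H3 : `|F t - F s - f t * (t - s)| <= L * (t - s).
  apply: (le_trans (ler_normB _ _)); rewrite normrM (gtr0_norm ts0) /L.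
  have : `|F t - F s| <= K * (t - s) by rewrite ler_norml -mulNr H1.
  lra.
have H4 : L * (t - s) <= e * mu.
  move: sL; rewrite distrC gtr0_norm// => /ltW; rewrite ler_pdivlMr// mulrC.
  by [].
rewrite Ft (le_trans H3)// (le_trans H4)// ler_pM2l// ger0_norm; rewrite /mu; lra.
Qed.

End Antiderivative.

(** * Regularity of the delayed coefficients *)

Section LocallyBounded.
Context {R : realType}.
Implicit Types (D E : set R) (f g : R -> R) (t l : R).

Lemma cvg_near_bounded D f t l : f s @[s --> within D (nbhs t)] --> l ->
  exists K, \forall s \near within D (nbhs t), `|f s| <= K.
Proof.
move=> /cvgrPdist_le/(_ _ ltr01); exists (`|l| + 1).
near=> s; rewrite -[f s](subKr l) (le_trans (ler_normB _ _))// lerD2l.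
by near: s.
Unshelve. all: by end_near. Qed.

Lemma locally_boundedM D f g : locally_bounded D f -> locally_bounded D g ->
  locally_bounded D (f \* g).
Proof.
move=> Hf Hg t Dt; have [K HK] := Hf t Dt; have [L HL] := Hg t Dt.
exists (K * L); near=> s; rewrite normrM ler_pM//; first by near: s.
by near: s.
Unshelve. all: by end_near. Qed.

Lemma locally_bounded_comp D E f g : (forall s, D s -> E (g s)) ->
  (forall t, D t -> g s @[s --> within D (nbhs t)] --> g t) ->
  locally_bounded E f -> locally_bounded D (f \o g).
Proof.
move=> DE gc Hf t Dt; have [K HK] := Hf _ (DE _ Dt).
by exists K; exact: (cvg_within_self DE (gc _ Dt) HK).
Qed.

End LocallyBounded.

Section RdContinuous.
Context {R : realType} (T : set R).
Hypothesis (Tub : ~ has_ubound T).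
Implicit Types (D E : set R) (f g : R -> R) (s t : R).

Lemma rd_right_dense_continuous D f :
  rd_continuous T D f -> right_dense_continuous T D f.
Proof. by move=> H t Dt /(right_denseE Tub); case: (H t Dt). Qed.

(** On each side of [t] there is either a finite limit or, in the scattered case, a gap where any
    bound holds. *)
Lemma rd_locally_bounded D f : D `<=` T ->
  rd_continuous T D f -> locally_bounded D f.
Proof.
move=> DT H t Dt; have [Hr Hl] := H t Dt.
have [K HK] : exists K,
    \forall s \near within (D `&` [set s | s < t]) (nbhs t), `|f s| <= K.
  have [/Hl[l /cvg_near_bounded //]|nld] := pselect (left_dense T t).
  (* A minimum of [T] is split off, since [rho] is a junk supremum there. *)
  exists 0; have [[s Ts st]|ns] := pselect (exists2 s, T s & s < t); last first.
    apply/near_within_ballP; exists 1 => // s [/DT Ts st].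
    by exfalso; apply: ns; exists s.
  have rle r : T r -> r < t -> r <= rho T t.
    by move=> Tr rt; apply: ub_le_sup => //; exists t => ? [_ /ltW].
  have rt : rho T t < t.
    rewrite lt_neqAle; apply/andP; split.
      by apply/eqP => rt; apply: nld; split=> //; exists s.
    by apply: ge_sup; [exists s|move=> ? [_ /ltW]].
  apply/near_within_ballP; exists (t - rho T t); first by rewrite subr_gt0.
  move=> r [/DT Tr /= rt']; have := rle _ Tr rt'.
  by rewrite ltr0_norm ?subr_lt0//; lra.
have [L HL] : exists L,
    \forall s \near within (D `&` [set s | t < s]) (nbhs t), `|f s| <= L.
  have [/(right_denseE Tub)/Hr/cvg_near_bounded[L HL]|tt] := eqVneq (sigma T t) t.
    by exists L; apply: near_within_subset HL.
  have {}tt : t < sigma T t by rewrite lt_neqAle eq_sym tt sigma_ge.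
  exists 0; apply/near_within_ballP; exists (sigma T t - t); first by rewrite subr_gt0.
  move=> r [/DT Tr /= rt']; have := sigma_le Tub Tr rt'.
  by rewrite gtr0_norm ?subr_gt0//; lra.
exists (Num.max `|f t| (Num.max K L)).
have sub : D `<=` (D `&` [set s | s < t]) `|` (D `&` [set s | t < s]) `|` [set t].
  by move=> s Ds; have [st|st|->] := ltgtP s t; [left; left|left; right|right].
apply: near_within_subset sub _; apply: near_withinU; first apply: near_withinU.
- by apply: filterS HK => s; rewrite !le_max => ->; rewrite orbT.
- by apply: filterS HL => s; rewrite !le_max => ->; rewrite !orbT.
- by apply/near_within_ballP; exists 1 => // s -> _; rewrite le_max lexx.
Qed.

End RdContinuous.

(** * Order isomorphisms between half-lines of the time scale *)

Section OrderIsomorphism.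
Context {R : realType} (T : set R) (c : R) (g k : R -> R).
Hypotheses (Tcl : closed T) (Tub : ~ has_ubound T) (Tc : T c).
Hypothesis g_incr : forall s t, ts_ge T c s -> ts_ge T c t -> s < t -> g s < g t.
Hypothesis g_onto : g @` ts_ge T c = ts_ge T (g c).
Hypothesis gK : forall t, ts_ge T c t -> k (g t) = t.
Implicit Types (s t r : R).

Lemma iso_ltE s t : ts_ge T c s -> ts_ge T c t -> (g s < g t) = (s < t).
Proof.
move=> Ds Dt; have [st|ts|->] := ltgtP s t; last by rewrite ltxx.
  exact: g_incr.
by apply/negbTE; rewrite -leNgt ltW// g_incr.
Qed.

Lemma iso_leE s t : ts_ge T c s -> ts_ge T c t -> (g s <= g t) = (s <= t).
Proof. by move=> Ds Dt; rewrite !leNgt iso_ltE. Qed.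

Lemma iso_mem t : ts_ge T c t -> ts_ge T (g c) (g t).
Proof. by move=> Dt; rewrite -g_onto; exists t. Qed.

Lemma iso_inv r : ts_ge T (g c) r -> ts_ge T c (k r) /\ g (k r) = r.
Proof. by rewrite -g_onto => -[t Dt <-]; rewrite gK. Qed.

Lemma iso_lift r : T r -> g c <= r -> exists2 t, ts_ge T c t & g t = r.
Proof.
move=> Tr cr; have : ts_ge T (g c) r by apply/ts_geE.
by rewrite -g_onto => -[t Dt gt]; exists t.
Qed.

(** Let [u] be the preimage of [sigma T (g t)]. If [u < sigma T t], then [u = t], so [g t] is
    right-dense and a point just above it has its preimage strictly between [t] and [sigma T t]. If
    [sigma T t < u], then [t] is right-dense and a point between [t] and [u] maps strictly between
    [g t] and [sigma T (g t)]. *)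
Lemma iso_sigma t : ts_ge T c t -> g (sigma T t) = sigma T (g t).
Proof.
move=> Dt; have Ds := ts_ge_sigma Tcl Tub Dt.
have [Tgs _] := iso_mem Ds; have /ts_geE[Tgt cgt] := iso_mem Dt.
have ts := sigma_ge Tub t.
have [u Du gu] : exists2 u, ts_ge T c u & g u = sigma T (g t).
  by apply: iso_lift; [exact: sigma_mem|exact: le_trans cgt (sigma_ge Tub _)].
have tu : t <= u by rewrite -iso_leE// gu sigma_ge.
apply/eqP; rewrite eq_le -gu !iso_leE//; apply/andP.
split; rewrite leNgt; apply/negP => lt.
  have ut : u = t.
    apply/eqP; rewrite eq_le tu andbT leNgt; apply/negP => /(sigma_le Tub Du.1).
    by rewrite leNgt lt.
  have gtt : sigma T (g t) = g t by rewrite -gu ut.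
  have e0 : 0 < g (sigma T t) - g t by rewrite subr_gt0 iso_ltE// -[X in X < _]ut.
  have [r Tr /andP[tr rs]] := right_dense_near Tub gtt e0.
  have [v Dv gv] := iso_lift Tr (le_trans cgt (ltW tr)).
  move: tr rs; rewrite subrKC -gv !iso_ltE// => /(sigma_le Tub Dv.1) sv.
  by rewrite ltNge sv.
have [tt|tt] := eqVneq (sigma T t) t; last first.
  have : g t < g (sigma T t) by rewrite iso_ltE// lt_neqAle eq_sym tt.
  by move=> /(sigma_le Tub Tgs); rewrite -gu iso_leE// leNgt lt.
have e0 : 0 < u - t by rewrite subr_gt0 -tt.
have [v Tv /andP[tv vu]] := right_dense_near Tub tt e0.
have Dv : ts_ge T c v.
  by apply/ts_geE; split=> //; move/ts_geE: Dt => [_ ct]; exact: le_trans ct (ltW tv).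
have := g_incr Dt Dv tv; move=> /(sigma_le Tub (iso_mem Dv).1).
by rewrite -gu iso_leE//; rewrite subrKC in vu; rewrite leNgt vu.
Qed.

Lemma iso_inv_sigma r : ts_ge T (g c) r -> sigma T r = r -> sigma T (k r) = k r.
Proof.
move=> /iso_inv[Dk gk] rr; have Dsk := ts_ge_sigma Tcl Tub Dk.
by rewrite -(gK Dsk) iso_sigma// gk rr.
Qed.

(** Continuity of the inverse comes from the order: cut points of [T] around [t] bound an
    [e]-neighbourhood, and their images under [g] bound a neighbourhood of [g t]. *)
Lemma iso_inv_cvg r : ts_ge T (g c) r ->
  k s @[s --> within (ts_ge T (g c)) (nbhs r)] --> k r.
Proof.
move=> Dr; have [Dt gt] := iso_inv Dr; move: (k r) Dt gt => t Dt <-{Dr}.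
have /ts_geE[Tt ct] := Dt.
apply/cvgrPdist_lt => e e0.
have [u [Tu tu Hu]] := right_cut Tcl Tub t e0.
have Du : ts_ge T c u by apply/ts_geE; split=> //; exact: le_trans ct (ltW tu).
have [d d0 Hd] : exists2 d, 0 < d & forall s, ts_ge T c s -> s <= t ->
    g t - d < g s -> t - e < s.
  move: ct; rewrite le_eqVlt => /predU1P[ct|ct].
    (* At the left endpoint [c] nothing lies further left, so any [d] serves. *)
    by exists 1 => // s /ts_geE[_]; rewrite ct => ? _ _; lra.
  have [v [Tv cv vt Hv]] := left_cut Tcl Tc ct e0.
  have Dv : ts_ge T c v by apply/ts_geE.
  exists (g t - g v); first by rewrite subr_gt0 iso_ltE.
  by move=> s Ds st; rewrite subKr iso_ltE//; apply: Hv => //; case: Ds.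
apply/near_within_ballP; exists (Num.min d (g u - g t)).
  by rewrite lt_min d0 subr_gt0 iso_ltE.
move=> s Ds; rewrite lt_min => /andP[sd su]; have [Dk gk] := iso_inv Ds.
rewrite -gk in sd su; move: (k s) Dk sd su => {gk Ds}s Ds sd su.
rewrite distrC; have [st|/ltW ts] := leP s t.
  rewrite ler0_norm ?subr_le0//.
  suff : t - e < s by lra.
  apply: Hd => //; move: sd; rewrite ler0_norm ?subr_le0 ?iso_leE//; lra.
rewrite ger0_norm ?subr_ge0// ltrBlDl; apply: Hu => //; first by case: Ds.
rewrite -iso_ltE//; move: su; rewrite ger0_norm ?subr_ge0 ?iso_leE//; lra.
Qed.

End OrderIsomorphism.

(** * Integral inequalities *)

Section HalfLine.
Context {R : realType} (T : set R) (c : R).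
Hypotheses (Tcl : closed T) (Tub : ~ has_ubound T).
Implicit Types (f h F G H : R -> R) (s t r l m p : R).

Let antiderivative f F :=
  forall t, ts_ge T c t -> is_delta_derive T (ts_ge T c) F t (f t).

Lemma ts_cc_sub_ge s t : ts_ge T c s -> ts_cc T s t `<=` ts_ge T c.
Proof.
move=> /ts_geE[_ cs] r [Tr /=]; rewrite in_itv/= => /andP[sr _].
by apply/ts_geE; split=> //; exact: le_trans cs sr.
Qed.

(** Agreement on [[s, t[] suffices. The iterated integral uses this, with [h r] an integral from [r]
    up to [t]. *)
Lemma antiderivative_on f h F s t : ts_ge T c s -> antiderivative f F ->
  (forall r, ts_co T s t r -> h r = f r) -> delta_antiderivative T h s t F.
Proof.
move=> Ds HF hf; split.
  apply/subspace_continuousP => r /(ts_cc_sub_ge Ds) Dr.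
  exact: cvg_within_subset (ts_cc_sub_ge Ds) (is_delta_derive_cvg Dr (HF _ Dr)).
move=> r Dr; rewrite hf//; apply: is_delta_derive_sub (ts_cc_sub_ge Ds) _.
apply: HF; apply: (ts_cc_sub_ge (t := t) Ds).
case: Dr => Tr /=; rewrite in_itv/= => /andP[sr /ltW rt].
by split=> //=; rewrite in_itv/= sr.
Qed.

Lemma delta_int_antiderivative f h F s t : ts_ge T c s -> ts_ge T c t -> s <= t ->
  antiderivative f F -> (forall r, ts_co T s t r -> h r = f r) ->
  delta_int T s t h = F t - F s.
Proof.
move=> Ds Dt st HF hf; apply: delta_intE Ds.1 Dt.1 st _ => //.
exact: antiderivative_on hf.
Qed.

Lemma antiderivative_ge0_le f F s t : ts_ge T c s -> ts_ge T c t -> s <= t ->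
  antiderivative f F -> (forall r, ts_ge T c r -> s <= r -> 0 <= f r) -> F s <= F t.
Proof.
move=> Ds Dt st HF f0.
have [Fc Fd] := antiderivative_on (t := t) Ds HF (fun r _ => erefl (f r)).
apply: (delta_derive_ge0_le Tcl Tub Ds.1 Dt.1 st Fc) => r Dr.
exists (f r); last exact: Fd.
case: Dr => Tr /=; rewrite in_itv/= => /andP[sr _]; apply: f0 => //.
by move/ts_geE: Ds => [_ cs]; apply/ts_geE; split=> //; exact: le_trans cs sr.
Qed.

(* [(f - p)^2 >= 0] integrates to a quadratic in [p], taken at its minimum. *)
Lemma antiderivative_sqr_le f F G s t : ts_ge T c s -> ts_ge T c t -> s < t ->
  antiderivative f F -> antiderivative (fun r => f r ^+ 2) G ->
  (F t - F s) ^+ 2 <= (t - s) * (G t - G s).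
Proof.
move=> Ds Dt st HF HG; have ts0 : 0 < t - s by rewrite subr_gt0.
pose p := (F t - F s) / (t - s).
pose H := (G \- (2 * p) \*o F) \+ (p ^+ 2 \*o id).
have HH : antiderivative (fun r => f r ^+ 2 - 2 * p * f r + p ^+ 2 * 1) H.
  move=> r Dr; apply: is_delta_deriveD.
    apply: is_delta_deriveB => //; first exact: HG.
    by apply: is_delta_deriveZ => //; exact: HF.
  by apply: is_delta_deriveZ => //; exact: is_delta_derive_id.
have : H s <= H t.
  apply: antiderivative_ge0_le HH _ => // [|r _ _]; first exact: ltW.
  have -> : f r ^+ 2 - 2 * p * f r + p ^+ 2 * 1 = (f r - p) ^+ 2 by ring.
  exact: sqr_ge0.
rewrite /H/= => Hle.
have Fp : F t - F s = p * (t - s) by rewrite /p divfK ?gt_eqF.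
have -> : (F t - F s) ^+ 2 = (t - s) * (2 * p * (F t - F s) - p ^+ 2 * (t - s)).
  by rewrite Fp; ring.
by apply: ler_wpM2l; [exact: ltW|lra].
Qed.

(** Integrates [F r - F s >= 0]. With [W] and [Z] for [F] and [G], it bounds the integral of
    [W t - W s] over [[g t, t]] by [beta t * (W t - W (g t))]. *)
Lemma antiderivative_homo_ge F G s t : ts_ge T c s -> ts_ge T c t -> s <= t ->
  antiderivative F G -> (forall r, ts_ge T c r -> s <= r -> F s <= F r) ->
  F s * (t - s) <= G t - G s.
Proof.
move=> Ds Dt st HG Fs.
pose H := G \- (F s \*o id).
have HH : antiderivative (fun r => F r - F s * 1) H.
  move=> r Dr; apply: is_delta_deriveB => //; first exact: HG.
  by apply: is_delta_deriveZ => //; exact: is_delta_derive_id.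
have : H s <= H t.
  by apply: antiderivative_ge0_le HH _ => // r Dr sr; rewrite mulr1 subr_ge0 Fs.
by rewrite /H/=; lra.
Qed.

End HalfLine.

(** [I] and [W1] stand for the integrals of [f] and [f ^+ 2] over the delay interval, [W2] for the
    iterated one. The cross terms in [x * I] cancel; left minus right side is [(Q + m * Q ^+ 2 + la
    * (be + m) * b ^+ 2) * x ^+ 2 - la * m * gD * (b * x) ^+ 2 - Q * I ^+ 2 - la * Q * W2 - la * gD
    * W1]. *)
Lemma lyapunov_estimate (R : realFieldType) (x I W1 W2 be m Q gD b la : R) :
  0 < la -> 0 < be -> 0 <= m -> 0 <= gD ->
  I ^+ 2 <= be * W1 -> W2 <= be * W1 -> 0 <= W1 ->
  - (la * gD / (be + la * (be + m))) <= Q ->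
  Q <= - (la * (be + m) * b ^+ 2) - m * Q ^+ 2 ->
  (2 * (x + I) + m * (Q * x)) * (Q * x)
    + la * ((be + m * (1 - gD)) * (b * x) ^+ 2 - gD * W1)
  <= Q * ((x + I) ^+ 2 + la * W2).
Proof.
move=> la0 be0 m0 gD0 IW W21 W10 Ql Qu.
have la1 := ltW la0; have bm0 : 0 <= be + m by rewrite addr_ge0// ltW.
have den0 : 0 < be + la * (be + m) by rewrite ltr_pwDl// mulr_ge0.
have Q0 : 0 <= - Q.
  have H1 : 0 <= la * (be + m) * b ^+ 2 by rewrite mulr_ge0 ?sqr_ge0// mulr_ge0.
  have H2 : 0 <= m * Q ^+ 2 by rewrite mulr_ge0 ?sqr_ge0.
  lra.
(* As [- Q >= 0], the term [la * m] of the denominator may be dropped; the rest matches the sum of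
   the bounds [H3] and [H4]. *)
have HQ : - Q * (be + la * be) <= la * gD.
  move: Ql; rewrite lerNl ler_pdivlMr// => Ql; apply: le_trans Ql.
  by apply: ler_wpM2l => //; rewrite lerD2l ler_wpM2l// lerDl.
have H1 : (Q + m * Q ^+ 2 + la * (be + m) * b ^+ 2) * x ^+ 2 <= 0.
  by rewrite mulr_le0_ge0 ?sqr_ge0//; lra.
have H2 : 0 <= la * m * gD * (b * x) ^+ 2.
  by rewrite mulr_ge0 ?sqr_ge0// !mulr_ge0.
have H3 : - Q * I ^+ 2 <= - Q * (be * W1) by exact: ler_wpM2l.
have H4 : - Q * W2 * la <= - Q * (be * W1) * la.
  by apply: ler_wpM2r => //; exact: ler_wpM2l.
have H5 : - Q * (be + la * be) * W1 <= la * gD * W1 by exact: ler_wpM2r.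
nra.
Qed.

(** * The Lyapunov functional *)

Section Gluing.
Context {R : realType} (T : set R) (c t0 : R) (psi x : R -> R).
Hypotheses (Tcl : closed T) (Tub : ~ has_ubound T).
Hypothesis psi_rd : rd_continuous T (ts_cc T c t0) psi.
Hypothesis x_psi : forall t, ts_cc T c t0 t -> x t = psi t.
Hypothesis x_cont : forall t, ts_ge T t0 t ->
  x s @[s --> within (ts_ge T t0) (nbhs t)] --> x t.

Let split_ge : ts_ge T c `<=` ts_cc T c t0 `|` ts_ge T t0.
Proof.
move=> s /ts_geE[Ts cs]; have [st|/ltW ts] := leP s t0; [left|right].
  by split=> //=; rewrite in_itv/= cs.
by apply/ts_geE.
Qed.

Let cc_closed : closed (ts_cc T c t0).
Proof. by apply: closedI => //; exact: interval_closed. Qed.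

Let ge_closed : closed (ts_ge T t0).
Proof. by apply: closedI => //; exact: interval_closed. Qed.

(** Two closed pieces cover [[c, oo[]; along each piece containing [t] the limit is [x t], and a
    piece missing [t] imposes nothing. *)
Lemma glued_right_dense_continuous : right_dense_continuous T (ts_ge T c) x.
Proof.
move=> t Dt tt; apply: cvg_within_subset split_ge _; apply: cvg_withinU.
  have [ccs|ncc] := pselect (ts_cc T c t0 t).
    rewrite x_psi//; apply: cvg_within_eq (rd_right_dense_continuous Tub psi_rd ccs tt).
    by move=> s /x_psi.
  by apply/cvgrPdist_lt => e _; exact: near_within_notin.
have [/x_cont //|nge] := pselect (ts_ge T t0 t).
by apply/cvgrPdist_lt => e _; exact: near_within_notin.
Qed.

Lemma glued_locally_bounded : locally_bounded (ts_ge T c) x.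
Proof.
move=> t Dt.
have [K HK] : exists K, \forall s \near within (ts_cc T c t0) (nbhs t), `|x s| <= K.
  have [ccs|ncc] := pselect (ts_cc T c t0 t); last first.
    by exists 0; exact: near_within_notin.
  have [K HK] := rd_locally_bounded Tub (@subIsetl _ _ _) psi_rd ccs; exists K.
  rewrite !near_withinE in HK *; apply: filterS HK => s Hs Ds.
  by rewrite x_psi//; exact: Hs.
have [L HL] : exists L, \forall s \near within (ts_ge T t0) (nbhs t), `|x s| <= L.
  have [/x_cont/cvg_near_bounded //|nge] := pselect (ts_ge T t0 t).
  by exists 0; exact: near_within_notin.
exists (Num.max K L); apply: near_within_subset split_ge _; apply: near_withinU.
  by apply: filterS HK => s; rewrite le_max => ->.
by apply: filterS HL => s; rewrite le_max => ->; rewrite orbT.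
Qed.

End Gluing.

Lemma shift_dom_mem (R : realType) (T Ts : set R) t0 d s t :
  shift_dom T Ts t0 d s t -> Ts (shift_val d s t).
Proof. by case=> _ _ [v dv Tv]; rewrite /shift_val dv. Qed.

(** The forward shift by [t0] is the identity by [shift_P3], hence so is the backward one by
    [shift_P4]; since [t0 < h], [shift_P2] puts the backward shift by [h] strictly below it. *)
Lemma delay_lt (R : realType) (T Ts : set R) t0 dm dp h t :
  shift_operators T Ts t0 dm dp -> delay_shift T Ts t0 dm dp h ->
  ts_ge T t0 t -> shift_val dm h t < t.
Proof.
move=> [_ _ _ [[P2 _] [_ P3]] [[_ P4] _]] dh Dt.
have [Dh _] := delay_dom dh Dt; have Tst : Ts t by case: Dh.
have [D0 v0] := P3 _ Tst; have [] := P4 _ _ D0; rewrite v0 => D0' v0'.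
rewrite -[X in _ < X]v0'; apply: P2 => //.
by have [_ /=] := delay_mem dh; rewrite in_itv/= andbT.
Qed.

Theorem lemma4 (R : realType) (T Ts : set R) (t0 : R)
    (dm dp : R -> R -> option R) (h : R) (a b psi x : R -> R) (M lambda : R)
    (Tts : time_scale T) (Tunb : ~ has_ubound T)
    (shiftT : shift_operators T Ts t0 dm dp)
    (delayh : delay_shift T Ts t0 dm dp h)
    (t0_ge0 : 0 <= t0)
    (a_rd : rd_continuous T T a) (b_rd : rd_continuous T T b) :
  let g := shift_val dm h in
  let k := shift_val dp h in
  let gD := delta_derive T (ts_ge T t0) g in
  let Q := fun t => a t + b (k t) in
  let beta := fun t => t - g t in
  let A := fun t => x t + delta_int T (g t) t (fun s => b (k s) * x s) in
  let V := fun t => A t ^+ 2 + lambda *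
    delta_int T (g t) t
      (fun s => delta_int T s t (fun u => b (k u) ^+ 2 * x u ^+ 2)) in
  (forall t, ts_ge T t0 t -> `|gD t| <= M) ->
  rd_continuous T (ts_cc T (g t0) t0) psi ->
  delay_solution T t0 a b g psi x ->
  0 < lambda ->
  (forall t, ts_ge T t0 t ->
     - (lambda * gD t / (beta t + lambda * (beta t + mu T t))) <= Q t /\
     Q t <= - (lambda * (beta t + mu T t) * b (k t) ^+ 2) - mu T t * Q t ^+ 2) ->
  forall t, ts_ge T t0 t ->
    delta_derivable T (ts_ge T t0) V t /\
    delta_derive T (ts_ge T t0) V t <= Q t * V t.
Proof.
move=> g k gD Q beta A V _ psi_rd [x_psi x_eq] lambda0 hyp.
have [_ Tcl] := Tts.
have [TsT Tst0 _ _ _] := shiftT; have Tt0 : T t0 by exact: TsT.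
have Dt0 : ts_ge T t0 t0 by apply/ts_geE.
have gT t : ts_ge T t0 t -> T (g t).
  by move=> /(delay_dom delayh)[/shift_dom_mem/TsT].
have glt t : ts_ge T t0 t -> g t < t by exact: (delay_lt shiftT delayh).
have g_incr : forall s t, ts_ge T t0 s -> ts_ge T t0 t -> s < t -> g s < g t.
  exact: delay_increasing delayh.
have g_onto : g @` ts_ge T t0 = ts_ge T (g t0) by exact: delay_onto delayh.
have gK : forall t, ts_ge T t0 t -> k (g t) = t by exact: delay_inverse delayh.
set D := ts_ge T t0; set E := ts_ge T (g t0).
have DE : D `<=` E.
  move=> t /ts_geE[Tt tt]; apply/ts_geE; split=> //.
  exact: le_trans (ltW (glt _ Dt0)) tt.
have gE t : D t -> E (g t) by exact: (iso_mem g_onto).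
have Dx t : D t -> is_delta_derive T D x t (a t * x t + b t * x (g t) * gD t).
  move=> Dt; have [xd <-] := x_eq _ Dt.
  exact: (delta_derivableP Tunb Dt).
have Dg t : D t -> is_delta_derive T D g t (gD t).
  by move=> Dt; apply: (delta_derivableP Tunb Dt); exact: (delay_derivable delayh).
have x_cont t : D t -> x s @[s --> within D (nbhs t)] --> x t.
  by move=> Dt; exact: is_delta_derive_cvg (Dx _ Dt).
have x_rdc : right_dense_continuous T E x.
  exact: (glued_right_dense_continuous Tcl Tunb psi_rd x_psi x_cont).
have x_bd : locally_bounded E x.
  exact: (glued_locally_bounded Tcl Tunb psi_rd x_psi x_cont).
have kT r : E r -> T (k r) by move=> /(iso_inv g_onto gK)[[]].
have k_cvg r : E r -> k s @[s --> within E (nbhs r)] --> k r.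
  exact: (iso_inv_cvg Tcl Tunb Tt0 g_incr g_onto gK).
have bk_rdc : right_dense_continuous T E (b \o k).
  move=> r Er rr; have := iso_inv_sigma Tcl Tunb g_incr g_onto gK Er rr.
  move=> /(rd_right_dense_continuous Tunb b_rd (kT _ Er)).
  exact: cvg_comp (cvg_within_self kT (k_cvg _ Er)).
have bk_bd : locally_bounded E (b \o k).
  exact: locally_bounded_comp kT k_cvg (rd_locally_bounded Tunb (fun _ => id) b_rd).
pose f := (b \o k) \* x.
have f_rdc : right_dense_continuous T E f.
  by move=> r Er rr; apply: cvgM; [exact: bk_rdc|exact: x_rdc].
have f_bd : locally_bounded E f by exact: locally_boundedM.
have Tgt0 : T (g t0) by exact: gT.
(* Antiderivatives are taken on [E], which reaches back to [g t0], because the integrals start at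
   [g t]. *)
have [B HB] := exists_antiderivative Tcl Tunb Tgt0 f_bd f_rdc.
have [W HW] : exists W, forall t, E t -> is_delta_derive T E W t (f t ^+ 2).
  apply: (exists_antiderivative Tcl Tunb Tgt0).
    exact: locally_boundedM.
  by move=> r Er rr; apply: cvgM; exact: f_rdc.
have [Z HZ] : exists Z, forall t, E t -> is_delta_derive T E Z t (W t).
  apply: (exists_antiderivative Tcl Tunb Tgt0).
    by move=> r Er; apply: cvg_near_bounded; exact: is_delta_derive_cvg (HW _ Er).
  by move=> r Er _; exact: is_delta_derive_cvg (HW _ Er).
have int_w s t : E s -> E t -> s <= t ->
    delta_int T s t (fun u => b (k u) ^+ 2 * x u ^+ 2) = W t - W s.
  move=> Es Et st; apply: (delta_int_antiderivative Tcl Tunb Es Et st HW) => r _.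
  by rewrite /f/= exprMn.
pose A' := x \+ (B \- (B \o g)).
pose V' := A' \* A' \+ lambda \*o ((id \- g) \* W \- (Z \- (Z \o g))).
have VE : {in D, V' =1 V}.
  move=> t /set_mem Dt; have Et := DE _ Dt; have Egt := gE _ Dt.
  have gt := ltW (glt _ Dt).
  rewrite /V /A (delta_int_antiderivative Tcl Tunb Egt Et gt HB) => [|//].
  (* For fixed [t], [W t - W r] has antiderivative [W t * r - Z r] in [r]; the inner integral has
     this form for every [r] in [[g t, t[]. *)
  rewrite (delta_int_antiderivative (f := fun r => W t - W r)
    (F := (W t \*o id) \- Z) Tcl Tunb Egt Et gt) => [|r Er|r [Tr /=]].
  - by rewrite /V' /A' /=; ring.
  - apply: is_delta_deriveB => //; last exact: HZ.
    by have := is_delta_deriveZ (W t) Er (is_delta_derive_id T E r); rewrite mulr1.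
  - rewrite in_itv/= => /andP[gr rt]; apply: int_w => //; last exact: ltW.
    by move/ts_geE: Egt => [_ cg]; apply/ts_geE; split=> //; exact: le_trans cg gr.
move=> t Dt; have Et := DE _ Dt; have Egt := gE _ Dt; have gt := glt _ Dt.
have Dst := ts_ge_sigma Tcl Tunb Dt.
have on_D F l : is_delta_derive T E F t l -> is_delta_derive T D F t l.
  exact: is_delta_derive_sub.
have comp_g F l : is_delta_derive T E F (g t) l ->
    is_delta_derive T D (F \o g) t (l * gD t).
  move=> HF; apply: (is_delta_derive_comp Dt gE _ _ HF (Dg _ Dt)).
    by move=> s Ds gs; rewrite -(gK s)// gs gK.
  exact: (iso_sigma Tcl Tunb g_incr g_onto Dt).
have DA : is_delta_derive T D A' t (Q t * x t).
  (* Since [k (g t) = t], the delayed term of the equation is [f (g t) * gD t] and cancels against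
     the derivative of [B \o g]. *)
  have -> : Q t * x t =
      a t * x t + b t * x (g t) * gD t + (f t - f (g t) * gD t).
    by rewrite /Q /f/= gK//; ring.
  apply: is_delta_deriveD; first exact: Dx.
  by apply: is_delta_deriveB => //; [exact/on_D/HB|exact/comp_g/HB].
have As := is_delta_derive_sigma Dt DA.
have gs := is_delta_derive_sigma Dt (Dg _ Dt).
(* The first factor is [A' t + A' (sigma T t)], from the product rule for the square. *)
pose l := (2 * A' t + mu T t * (Q t * x t)) * (Q t * x t) +
  lambda * ((beta t + mu T t * (1 - gD t)) * f t ^+ 2 - gD t * (W t - W (g t))).
have DV : is_delta_derive T D V t l.
  apply: eq_is_delta_derive VE _ => //.
  (* At the jump, [id \- g] equals [beta t + mu T t * (1 - gD t)]; the terms in [W t] free of [gD t]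
     cancel. *)
  have -> : l = Q t * x t * A' t + A' (sigma T t) * (Q t * x t) +
      lambda * (((1 - gD t) * W t + (id \- g) (sigma T t) * f t ^+ 2) -
                (W t - W (g t) * gD t)).
    have st : sigma T t = t + mu T t by rewrite /mu addrC subrK.
    by rewrite /l As /= gs /beta st; ring.
  apply: is_delta_deriveD; first exact: is_delta_deriveM.
  apply: is_delta_deriveZ => //; apply: is_delta_deriveB => //.
    apply: is_delta_deriveM => //; last exact/on_D/HW.
    by apply: is_delta_deriveB => //; [exact: is_delta_derive_id|exact: Dg].
  by apply: is_delta_deriveB => //; [exact/on_D/HZ|exact/comp_g/HZ].
split; first by exists l.
rewrite (delta_deriveE Tunb Dt DV) -VE ?inE// /V'/= -expr2 /l.
have [Ql Qu] := hyp _ Dt.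
have W_homo r s : E r -> E s -> r <= s -> W r <= W s.
  move=> Er Es rs; apply: (antiderivative_ge0_le Tcl Tunb Er Es rs HW) => u _ _.
  exact: sqr_ge0.
have -> : f t = b (k t) * x t by [].
apply: lyapunov_estimate Ql Qu => //.
- by rewrite subr_gt0.
- exact: mu_ge0.
- apply: (is_delta_derive_homo_ge0 Tcl Tunb Dt _ (Dg _ Dt)) => r s Dr Ds rs.
  exact/ltW/g_incr.
- exact: (antiderivative_sqr_le Tcl Tunb Egt Et gt HB HW).
- have := antiderivative_homo_ge Tcl Tunb Egt Et (ltW gt) HZ.
  move=> /(_ (fun r Er => W_homo _ _ Egt Er)); rewrite /beta; lra.
- by rewrite subr_ge0 W_homo// ltW.
Qed.
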